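(* Let $\mathcal X$ be a real linear space, $\mathcal X_0:=\mathcal X\setminus\{0\}$, $\mathcal Y$ a real Banach space, and $r,s,t$ positive integers. Let $f,g,h:\mathcal X\to\mathcal Y$ be mappings with $f(0)=g(0)=h(0)=0$ for which there exists a function $\varphi:\mathcal X_0\times\mathcal X_0\to[0,\infty)$ such that $$\left\|r f\!\left(\frac{sx+ty}{r}\right)-s\,g(x)-t\,h(y)\right\|\le\varphi\!\left(x,\tfrac ts y\right)$$ for all $x,y\in\mathcal X_0$. If $h$ is an even mapping, then for all $x\in\mathcal X_0$, $$\|f(x)\|\le\frac1r\,\varphi\!\left(\frac{rx}{2s},\frac{rx}{2s}\right)+\frac1r\,\varphi\!\left(\frac{rx}{2s},\frac{-rx}{2s}\right)$$ and $$\left\|g(x)+\frac ts\,h\!\left(\frac st x\right)\right\|\le\frac1s\,\varphi(x,-x).$$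
   Context: $h$ is even if $h(-x)=h(x)$ for all $x$. *)

(* Defs.v *)
From HB Require Import structures.
From mathcomp Require Export all_boot all_order all_algebra.
From mathcomp Require Export reals topology normedtype.

Set Implicit Arguments.
Unset Strict Implicit.
Unset Printing Implicit Defensive.

Export Order.TTheory GRing.Theory Num.Theory.
Export numFieldNormedType.Exports.

Local Open Scope ring_scope.

Definition even_map (X Y : zmodType) (h : X -> Y) : Prop :=
  forall x : X, h (- x) = h x.

(* Main.v *)
Require Import Defs.

(** At [y = - (s/t) x] the argument of [f] vanishes, and since [h] is even the
    hypothesis bounds [s g(x) + t h((s/t) x)] by [phi x (- x)], which is the
    second estimate.  At [y = (s/t) x] it bounds
    [r f(2 s x / r) - (s g(x) + t h((s/t) x))] by [phi x x]; adding the two and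
    replacing [x] by [r x / (2 s)] gives the first. *)

Local Open Scope ring_scope.

Theorem proposition4p2 (R : realType) (X : lmodType R)
    (Y : completeNormedModType R) (r s t : nat)
    (r_gt0 : (0 < r)%N) (s_gt0 : (0 < s)%N) (t_gt0 : (0 < t)%N)
    (f g h : X -> Y) (f0 : f 0 = 0) (g0 : g 0 = 0) (h0 : h 0 = 0)
    (phi : X -> X -> R)
    (phi_ge0 : forall x y : X, x != 0 -> y != 0 -> 0 <= phi x y)
    (fgh_phi : forall x y : X, x != 0 -> y != 0 ->
      `| r%:R *: f (r%:R^-1 *: (s%:R *: x + t%:R *: y))
         - s%:R *: g x - t%:R *: h y |
        <= phi x ((t%:R / s%:R) *: y))
    (h_even : even_map h) :
  forall x : X, x != 0 ->
    `| f x | <=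
        r%:R^-1 * phi ((r%:R / (2 * s%:R)) *: x) ((r%:R / (2 * s%:R)) *: x)
      + r%:R^-1 * phi ((r%:R / (2 * s%:R)) *: x) (- ((r%:R / (2 * s%:R)) *: x))
    /\ `| g x + (t%:R / s%:R) *: h ((s%:R / t%:R) *: x) |
        <= s%:R^-1 * phi x (- x).
Proof.
have rN0 : r%:R != 0 :> R by rewrite pnatr_eq0 -lt0n.
have sN0 : s%:R != 0 :> R by rewrite pnatr_eq0 -lt0n.
have tN0 : t%:R != 0 :> R by rewrite pnatr_eq0 -lt0n.
have tst : t%:R * (s%:R / t%:R) = s%:R :> R by rewrite mulrC divfK.
have tsst : t%:R / s%:R * (s%:R / t%:R) = 1 :> R.
  by rewrite mulrA divfK // divff.
(* The hypothesis only covers nonzero arguments, so the substituted [y] must be nonzero as well. *)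
have stN0 (u : X) : u != 0 -> (s%:R / t%:R) *: u != 0 :> X.
  by rewrite scaler_eq0 mulf_eq0 invr_eq0 !negb_or sN0 tN0.
have fgh_diag (u : X) : u != 0 ->
    `| r%:R *: f ((2 * s%:R / r%:R) *: u) - s%:R *: g u
       - t%:R *: h ((s%:R / t%:R) *: u) | <= phi u u.
  move=> uN0; have := fgh_phi _ _ uN0 (stN0 _ uN0).
  (* The factor [t / s] undoes [s / t] inside [phi], and the argument of [f] becomes a multiple of
     [s u + s u]. *)
  rewrite !scalerA tst tsst scale1r -scalerDl scalerA.
  by rewrite [r%:R^-1 * _]mulrC -mulr2n -[s%:R *+ 2]mulr_natl.
have gh_antidiag (u : X) : u != 0 ->
    `| s%:R *: g u + t%:R *: h ((s%:R / t%:R) *: u) | <= phi u (- u).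
  move=> uN0; have := fgh_phi u (- ((s%:R / t%:R) *: u)) uN0.
  rewrite oppr_eq0 => /(_ (stN0 _ uN0)).
  rewrite !scalerN !scalerA tst tsst scale1r subrr scaler0 f0 scaler0 h_even.
  (* With the sign inside [h] gone, both surviving terms carry a minus, which the norm absorbs. *)
  by rewrite sub0r -opprD normrN.
move=> x xN0; split.
  set u := (r%:R / (2 * s%:R)) *: x.
  have s2N0 : 2 * s%:R != 0 :> R by rewrite mulf_neq0 // pnatr_eq0.
  have uN0 : u != 0.
    by rewrite scaler_eq0 mulf_eq0 invr_eq0 !negb_or rN0 s2N0.
  have xE : (2 * s%:R / r%:R) *: u = x.
    by rewrite scalerA mulrA divfK // divff // scale1r.
  rewrite -mulrDr ler_pdivlMl ?ltr0n //.
  rewrite -{1}[r%:R]normr_nat -normrZ.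
  (* Subtracting and adding the antidiagonal sum splits the norm into one part for each of the two
     bounds at [u]. *)
  rewrite -[r%:R *: f x](subrK (s%:R *: g u + t%:R *: h ((s%:R / t%:R) *: u))).
  apply: le_trans (ler_normD _ _) (lerD _ (gh_antidiag _ uN0)).
  by rewrite opprD addrA -{1}xE; exact: fgh_diag.
rewrite ler_pdivlMl ?ltr0n //.
(* Moving [s] inside the norm turns the coefficient [t / s] of [h] into [t]. *)
rewrite -{1}[s%:R]normr_nat -normrZ scalerDr scalerA.
by rewrite mulrCA divff // mulr1; exact: gh_antidiag.
Qed.
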